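(* The problem JR-Probability under the 3VA model — given voters $V=[n]$, candidates $C$, committee size $k$, values $p_{i,c}\in\{0,0.5,1\}$, and a committee $W\subseteq C$ with $|W|=k$, compute the probability that $W$ satisfies JR — is solvable in polynomial time if $p_{i,c}\in\{0,1\}$ for all $i\in V$ and all $c\in W$.
   Context: An ABC instance consists of voters $V=[n]$, candidates $C=[m]$, an approval profile $A=(A_1,\dots,A_n)$ with $A_i\subseteq C$, and a positive integer $k$. A committee is a set $W\subseteq C$ with $|W|=k$. $W$ satisfies justified representation (JR) with respect to $A$ if for every $V'\subseteq V$ with $|V'|\ge \frac{n}{k}$ and $\bigcap_{i\in V'}A_i\neq\emptyset$, there is $i\in V'$ with $A_i\cap W\neq\emptyset$. In the 3VA model each voter $i$ approves each candidate $c$ independently with probability $p_{i,c}\in\{0,0.5,1\}$, yielding a random approval profile. *)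

(* Defs.v *)
From mathcomp Require Import all_boot all_order all_algebra.
Set Implicit Arguments. Unset Strict Implicit. Unset Printing Implicit Defensive.
Import Order.TTheory GRing.Theory Num.Theory.

(* A log-cost (bit-cost) random access machine: registers indexed by nat  *)
(* hold natural numbers; every step costs 1 plus the bit-lengths of all   *)
(* register addresses and values it touches.  This model is polynomially *)
(* equivalent to Turing machines.                                         *)

Inductive instr : Type :=
| IConst of nat & nat
| IAdd   of nat & nat & nat
| ISub   of nat & nat & nat
| IMul   of nat & nat & nat
| IDiv   of nat & nat & nat
| ILoad  of nat & nat
| IStore of nat & nat
| IJz    of nat & nat
| IHalt.

Record state : Type := State { pc : nat; regs : nat -> nat }.

Definition blen (x : nat) : nat := (Nat.log2 x).+1.

Definition upd (R : nat -> nat) (d v : nat) : nat -> nat :=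
  fun j => if j == d then v else R j.

Definition step (P : seq instr) (s : state) : option (state * nat) :=
  let R := regs s in
  let i := pc s in
  if size P <= i then None else
  match nth IHalt P i with
  | IConst d v => Some (State i.+1 (upd R d v), 1 + blen d + blen v)
  | IAdd d a b => Some (State i.+1 (upd R d (R a + R b)),
                        1 + blen d + blen a + blen b + blen (R a) + blen (R b))
  | ISub d a b => Some (State i.+1 (upd R d (R a - R b)),
                        1 + blen d + blen a + blen b + blen (R a) + blen (R b))
  | IMul d a b => Some (State i.+1 (upd R d (R a * R b)),
                        1 + blen d + blen a + blen b + blen (R a) + blen (R b))
  | IDiv d a b => Some (State i.+1 (upd R d (R a %/ R b)),
                        1 + blen d + blen a + blen b + blen (R a) + blen (R b))
  | ILoad d a => Some (State i.+1 (upd R d (R (R a))),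
                       1 + blen d + blen a + blen (R a) + blen (R (R a)))
  | IStore a s' => Some (State i.+1 (upd R (R a) (R s')),
                         1 + blen a + blen (R a) + blen s' + blen (R s'))
  | IJz r l => Some (State (if R r == 0 then l else i.+1) R,
                     1 + blen r + blen (R r) + blen l)
  | IHalt => None
  end.

Inductive halts_with (P : seq instr) : state -> nat -> state -> Prop :=
| HDone s : step P s = None -> halts_with P s 0 s
| HStep s s1 c t s' : step P s = Some (s1, c) -> halts_with P s1 t s' ->
    halts_with P s (c + t) s'.

Definition init (x : seq nat) : state :=
  State 0 (fun j => if j is j'.+1 then nth 0 x j' else size x).

Definition insize (x : seq nat) : nat := \sum_(v <- x) blen v.

Local Open Scope ring_scope.

Definition is_JR (n m k : nat) (A : {ffun 'I_n -> {set 'I_m}}) (W : {set 'I_m})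
  : bool :=
  [forall V' : {set 'I_n},
     ((n%:R / k%:R <= (#|V'|%:R : rat)) &&
      [exists c : 'I_m, [forall i in V', c \in A i]])
     ==> [exists i in V', A i :&: W != set0]].

Definition profile_prob (n m : nat) (p : 'I_n -> 'I_m -> rat)
  (A : {ffun 'I_n -> {set 'I_m}}) : rat :=
  \prod_(i : 'I_n) \prod_(c : 'I_m) (if c \in A i then p i c else 1 - p i c).

Definition JR_prob (n m k : nat) (p : 'I_n -> 'I_m -> rat) (W : {set 'I_m})
  : rat :=
  \sum_(A : {ffun 'I_n -> {set 'I_m}} | is_JR k A W) profile_prob p A.

Definition code_of (q : rat) : nat :=
  if q == 0 then 0%N else if q == 1 then 2%N else 1%N.

Definition encode (n m k : nat) (p : 'I_n -> 'I_m -> rat) (W : {set 'I_m})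
  : seq nat :=
  [:: n; m; k] ++ [seq nat_of_bool (c \in W) | c <- enum 'I_m]
    ++ [seq code_of (p i c) | i <- enum 'I_n, c <- enum 'I_m].

(* Main.v *)
Require Import Defs.
From mathcomp Require Import all_boot all_order all_algebra.
From mathcomp Require Import zify ring.
From Stdlib Require PeanoNat.
From Stdlib Require Import FunctionalExtensionality.
Set Implicit Arguments. Unset Strict Implicit. Unset Printing Implicit Defensive.
Import Order.TTheory GRing.Theory Num.Theory.

(* Whether a voter is represented by W is certain, and W fails JR exactly when *)
(* some candidate c is approved by at least n/k unrepresented voters.  These   *)
(* events are independent over c, so the probability is a product over c of    *)
(* partial sums of a Poisson binomial distribution.  Let e_i in {0,1,2} be     *)
(* twice the probability that voter i is unrepresented and approves c, and     *)
(* X = 2^(n+1).  The integer \prod_i ((2 - e_i) + e_i X) has, in base X, the   *)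
(* digits 2^n P(exactly t such voters); reducing it modulo X^T with            *)
(* T = ceil(n/k) and then modulo X - 1 sums the digits of index t < T.  So a   *)
(* RAM needs only nested loops and arithmetic on numbers of polynomial length. *)

(** * Running RAM code *)

(** The largest group that can object to W over a candidate consists of all unrepresented voters
    approving it, so JR only concerns these groups ([is_JRE]). Approvals inside W are almost surely
    fixed, so the unrepresented voters form a fixed set U and the probability is a product over
    candidates ([JR_probE]). [marginal] discards the voters outside U, [modn_genfun] evaluates the
    partial sums by two remainders, and [JR_prob_ngood] assembles the fraction.

    On the machine side, instructions are counted while one number bounds all bit-lengths. A block
    of bounded length inflates bit-lengths by a constant factor only, and loop invariants give the
    registers exactly, so growth does not accumulate. [triple_program] yields the count,
    [program_time] the polynomial. *)

Lemma blen_leq x L : 0 < L -> (blen x <= L) = (x < 2 ^ L).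
Proof.
move=> L0; rewrite /blen.
have E2 k : Nat.pow 2 k = 2 ^ k by elim: k => // k IH; rewrite expnS -IH /=; lia.
case: x => [|x]; first by rewrite expn_gt0 L0.
have h : (0 < x.+1)%coq_nat by lia.
have [h1 h2] := PeanoNat.Nat.log2_spec _ h; rewrite !E2 in h1 h2.
apply/idP/idP => H.
  apply: (@leq_trans (2 ^ (Nat.log2 x.+1).+1)); [by lia | by rewrite leq_exp2l].
rewrite ltnNge; apply/negP => H'.
have : 2 ^ L <= 2 ^ Nat.log2 x.+1 by rewrite leq_exp2l.
lia.
Qed.

(** [halts_with] only speaks of complete computations, so a partial run is described by how it
    prolongs every halting one. *)
Definition run P s t s' :=
  forall t2 s2, halts_with P s' t2 s2 -> halts_with P s (t + t2) s2.

Lemma run_trans P s1 t1 s2 t2 s3 :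
  run P s1 t1 s2 -> run P s2 t2 s3 -> run P s1 (t1 + t2) s3.
Proof. by move=> h1 h2 t s h; rewrite -addnA; apply/h1/h2. Qed.

Lemma run_step P s c s' : step P s = Some (s', c) -> run P s c s'.
Proof. by move=> h t s2; apply: HStep h. Qed.

Definition bits L (R : nat -> nat) := forall j, R j < 2 ^ L.

Definition exec1 (R : nat -> nat) (I : instr) : nat -> nat :=
  match I with
  | IConst d v => upd R d v
  | IAdd d a b => upd R d (R a + R b)
  | ISub d a b => upd R d (R a - R b)
  | IMul d a b => upd R d (R a * R b)
  | IDiv d a b => upd R d (R a %/ R b)
  | ILoad d a => upd R d (R (R a))
  | IStore a b => upd R (R a) (R b)
  | IJz _ _ | IHalt => R
  end.

(* The bound 20 is what the five bits granted to immediate operands allow. *)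
Definition straight (I : instr) : bool :=
  match I with
  | IConst a b | ILoad a b | IStore a b => (a <= 20) && (b <= 20)
  | IAdd d a b | ISub d a b | IMul d a b | IDiv d a b =>
      [&& d <= 20, a <= 20 & b <= 20]
  | IJz _ _ | IHalt => false
  end.

Lemma bits_leq L L' R : L <= L' -> bits L R -> bits L' R.
Proof. by move=> h H j; apply: leq_trans (H j) _; rewrite leq_exp2l. Qed.

Lemma bits_upd L R d v : bits L R -> v < 2 ^ L -> bits L (upd R d v).
Proof. by move=> H h j; rewrite /upd; case: eqP. Qed.

Lemma bits_exec1 L R I :
  straight I -> 5 <= L -> bits L R -> bits (2 * L) (exec1 R I).
Proof.
move=> hI hL H.
have L1 : 2 ^ L <= 2 ^ (2 * L) by rewrite leq_exp2l //; lia.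
have H2 : bits (2 * L) R by apply: bits_leq H; lia.
have L2 : 2 ^ (2 * L) = 2 ^ L * 2 ^ L by rewrite mul2n -addnn expnD.
have L3 : 20 < 2 ^ L by apply: (@leq_trans (2 ^ 5)) => //; rewrite leq_exp2l.
case: I hI => //= [d v|d a b|d a b|d a b|d a b|d a|a b] hI;
  apply: bits_upd => //.
- by apply: leq_trans L1; move: hI => /andP[_ h]; apply: leq_ltn_trans h L3.
- by rewrite L2; have := H a; have := H b; nia.
- by apply: leq_ltn_trans (H2 a); apply: leq_subr.
- by rewrite L2; apply: ltn_mul.
- by apply: leq_ltn_trans (H2 a); apply: leq_div.
Qed.

(* Bit-lengths at most double at each instruction, so a block of fixed length  *)
(* costs only a constant factor.                                               *)
Lemma bits_foldl l L R : all straight l -> 5 <= L -> bits L R ->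
  bits (2 ^ size l * L) (foldl exec1 R l).
Proof.
elim: l L R => [|I l IH] L R /=; first by rewrite mul1n.
move=> /andP[hI hl] hL hR; rewrite expnSr -mulnA; apply: IH => //; first by lia.
exact: bits_exec1.
Qed.

Definition code_at (P : seq instr) o l :=
  exists p q, P = p ++ l ++ q /\ size p = o.

Lemma code_at_cat P o l1 l2 :
  code_at P o (l1 ++ l2) -> code_at P o l1 /\ code_at P (o + size l1) l2.
Proof.
move=> [p [q [-> <-]]]; split.
  by exists p, (l2 ++ q); rewrite -!catA.
by exists (p ++ l1), q; rewrite size_cat -!catA.
Qed.

Lemma code_at_cons P o I l : code_at P o (I :: l) -> code_at P o.+1 l.
Proof. by rewrite -cat1s => /code_at_cat [_]; rewrite /= addn1. Qed.

Lemma code_at_nth P o I l : code_at P o (I :: l) -> nth IHalt P o = I /\ o < size P.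
Proof.
move=> [p [q [-> <-]]]; rewrite nth_cat ltnn subnn; split => //.
by rewrite size_cat /=; lia.
Qed.

Lemma step_straight P o R I l L :
    straight I -> 5 <= L -> bits L R -> code_at P o (I :: l) ->
  exists2 t, t <= 1 + 5 * L & step P (State o R) = Some (State o.+1 (exec1 R I), t).
Proof.
move=> hI hL H /code_at_nth [hn hs].
have L0 : 0 < L by lia.
have hb j : blen (R j) <= L by rewrite blen_leq.
have hc j : j <= 20 -> blen j <= L.
  move=> hj; rewrite blen_leq //; apply: (@leq_trans (2 ^ 5)).
    exact: (leq_ltn_trans hj).
  by rewrite leq_exp2l.
rewrite /step /= leqNgt hs hn /=.
case: I hI {hn} => //= [d v|d a b|d a b|d a b|d a b|d a|a b] hI;
  eexists; try reflexivity.
- by move: hI => /andP[/hc h1 /hc h2]; lia.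
- by move: hI => /and3P[/hc h1 /hc h2 /hc h3]; have := hb a; have := hb b; lia.
- by move: hI => /and3P[/hc h1 /hc h2 /hc h3]; have := hb a; have := hb b; lia.
- by move: hI => /and3P[/hc h1 /hc h2 /hc h3]; have := hb a; have := hb b; lia.
- by move: hI => /and3P[/hc h1 /hc h2 /hc h3]; have := hb a; have := hb b; lia.
- by move: hI => /andP[/hc h1 /hc h2]; have := hb a; have := hb (R a); lia.
- by move: hI => /andP[/hc h1 /hc h2]; have := hb a; have := hb b; lia.
Qed.

(* Code is a function of the address it is loaded at, jumps being absolute. *)
Definition code := nat -> seq instr.

Definition blk (l : seq instr) : code := fun=> l.

Definition cseq (c1 c2 : code) : code := fun o => c1 o ++ c2 (o + size (c1 o)).

(* [while R r != 0 do c]; register 16 must hold 0 for the backward jump. *)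
Definition loop r (c : code) : code := fun o =>
  IJz r (o + (size (c o.+1)).+2) :: c o.+1 ++ [:: IJz 16 o].

Definition triple L (c : code) R N R' := forall P o,
  blen (size P) <= L -> code_at P o (c o) ->
  exists2 t, t <= N * (1 + 5 * L) &
    run P (State o R) t (State (o + size (c o)) R').

Lemma triple_leq L c R N N' R' :
  N <= N' -> triple L c R N R' -> triple L c R N' R'.
Proof.
move=> h H P o h1 h2; have [t ht hr] := H P o h1 h2; exists t => //.
by apply: leq_trans ht _; rewrite leq_mul2r h orbT.
Qed.

Lemma triple_cseq L c1 c2 R1 N1 R2 N2 R3 :
  triple L c1 R1 N1 R2 -> triple L c2 R2 N2 R3 ->
  triple L (cseq c1 c2) R1 (N1 + N2) R3.
Proof.
move=> H1 H2 P o hP /code_at_cat [h1 h2].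
have [t1 ht1 hr1] := H1 _ _ hP h1; have [t2 ht2 hr2] := H2 _ _ hP h2.
exists (t1 + t2); first by rewrite mulnDl leq_add.
by rewrite /cseq size_cat addnA; apply: run_trans hr1 hr2.
Qed.

Lemma triple_blk l L L' R :
    all straight l -> 5 <= L -> bits L R -> 2 ^ size l * L <= L' ->
  triple L' (blk l) R (size l) (foldl exec1 R l).
Proof.
rewrite /triple /blk; elim: l L R => [|I l IH] L R /=.
  move=> _ _ _ _ P o _ _; exists 0 => //.
  by rewrite addn0; move=> t s.
move=> /andP[hI hl] hL hR hLL P o hP hc.
have hL' : L <= L' by apply: leq_trans hLL; rewrite leq_pmull // expn_gt0.
have [t1 ht1 /run_step hr1] :=
  step_straight hI (leq_trans hL hL') (bits_leq hL' hR) hc.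
have hL2 : 5 <= 2 * L by lia.
have hLL2 : 2 ^ size l * (2 * L) <= L' by rewrite mulnA -expnSr.
have [t2 ht2 hr2] :=
  IH _ _ hl hL2 (bits_exec1 hI hL hR) hLL2 P _ hP (code_at_cons hc).
exists (t1 + t2); first by rewrite mulSn leq_add.
by rewrite addnS -addSn; apply: run_trans hr1 hr2.
Qed.

Lemma step_jz P o r l q R : code_at P o (IJz r l :: q) ->
  step P (State o R) = Some (State (if R r == 0 then l else o.+1) R,
     1 + blen r + blen (R r) + blen l).
Proof. by move=> /code_at_nth [hn hs]; rewrite /step /= leqNgt hs hn. Qed.

Lemma blen_mono x y : x <= y -> blen x <= blen y.
Proof.
by move=> h; rewrite blen_leq //; apply: leq_ltn_trans h _; rewrite -blen_leq.
Qed.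

(** [F i] is the state with i iterations left. The test and the backward jump add 2 to each round,
    the last test adds the final 1. *)
Lemma triple_loop L r c (F : nat -> nat -> nat) N T :
    r <= 20 -> 5 <= L ->
    (forall i, F i r = i) -> (forall i, F i 16 = 0) ->
    (forall i, i <= N -> i < 2 ^ L) ->
    (forall i, i < N -> triple L c (F i.+1) T (F i)) ->
  triple L (loop r c) (F N) (N * (T + 2) + 1) (F 0).
Proof.
move=> hr hL hF hz hN hc P o hP hat.
have L0 : 0 < L by lia.
set e := o + (size (c o.+1)).+2.
have [hs1 hs2] : o <= size P /\ e <= size P.
  case: (hat) => [p [q [-> hp]]]; rewrite /e /loop !size_cat /= !size_cat /= hp.
  by move: (size (c o.+1)) (size q) => u v; lia.
have hb j : j <= 20 -> blen j <= L.
  move=> hj; rewrite blen_leq //; apply: (@leq_trans (2 ^ 5)).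
    exact: (leq_ltn_trans hj).
  by rewrite leq_exp2l.
have lo : blen o <= L by apply: leq_trans hP; apply: blen_mono.
have le : blen e <= L by apply: leq_trans hP; apply: blen_mono.
have -> : o + size (loop r c o) = e by rewrite /e /loop /= size_cat addn1.
have [at1 at2] : code_at P o.+1 (c o.+1) /\
    code_at P (o.+1 + size (c o.+1)) [:: IJz 16 o].
  exact/code_at_cat/(code_at_cons hat).
have hj R : step P (State o R) = Some (State (if R r == 0 then e else o.+1) R,
     1 + blen r + blen (R r) + blen e) := step_jz R hat.
elim: N hN hc => [|N IH] hN hc.
  eexists; last by apply: run_step; rewrite hj hF /=.
  by have := hb r hr; have -> : blen 0 = 1 by []; lia.
have [t1 ht1 hr1] := hc N (ltnSn N) P o.+1 hP at1.
have [|i hi|t2 ht2 hr2] := IH.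
- by move=> i hi; apply: hN; lia.
- by apply: hc; lia.
have r0 : run P (State o (F N.+1)) (1 + blen r + blen N.+1 + blen e)
   (State o.+1 (F N.+1)).
  by apply: run_step; rewrite hj hF.
have r3 : run P (State (o.+1 + size (c o.+1)) (F N)) (1 + blen 16 + blen 0 + blen o)
   (State o (F N)).
  by apply: run_step; rewrite (step_jz _ at2) hz.
eexists; last by apply: run_trans r0 (run_trans hr1 (run_trans r3 hr2)).
have h1 : blen N.+1 <= L by rewrite blen_leq // hN.
have h2 := hb r hr; have h3 := hb 16 isT; have h4 := hb 0 isT.
nia.
Qed.

(** * Symbolic execution on the low registers *)

Definition mk (l : seq nat) (M : nat -> nat) : nat -> nat :=
  fun j => if j < 19 then nth 0 l j else M j.

Definition lexec (M : nat -> nat) (l : seq nat) (I : instr) : seq nat :=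
  match I with
  | IConst d v => set_nth 0 l d v
  | IAdd d a b => set_nth 0 l d (nth 0 l a + nth 0 l b)
  | ISub d a b => set_nth 0 l d (nth 0 l a - nth 0 l b)
  | IMul d a b => set_nth 0 l d (nth 0 l a * nth 0 l b)
  | IDiv d a b => set_nth 0 l d (nth 0 l a %/ nth 0 l b)
  | ILoad d a => set_nth 0 l d (mk l M (nth 0 l a))
  | IStore _ _ | IJz _ _ | IHalt => l
  end.

Definition local (I : instr) : bool :=
  match I with
  | IConst d _ => d < 19
  | ILoad d a => (d < 19) && (a < 19)
  | IAdd d a b | ISub d a b | IMul d a b | IDiv d a b =>
      [&& d < 19, a < 19 & b < 19]
  | IStore _ _ | IJz _ _ | IHalt => false
  end.

Lemma upd_mk l M d v : d < 19 -> upd (mk l M) d v = mk (set_nth 0 l d v) M.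
Proof.
move=> hd; apply: functional_extensionality => j; rewrite /upd /mk nth_set_nth /=.
by case: eqP => [->|//]; rewrite hd.
Qed.

(** Without stores to memory, [M] stays fixed and a block acts on a finite list, so its effect is
    found by reduction. *)
Lemma foldl_exec1_mk l M b : all local b ->
  foldl exec1 (mk l M) b = mk (foldl (lexec M) l b) M.
Proof.
elim: b l => //= I b IH l /andP[hI hb]; rewrite -IH //; congr foldl.
have mkE j : j < 19 -> mk l M j = nth 0 l j by rewrite /mk => ->.
case: I hI => //= [d v hd|d x y /and3P[hd hx hy]|d x y /and3P[hd hx hy]
  |d x y /and3P[hd hx hy]|d x y /and3P[hd hx hy]|d x /andP[hd hx]];
  by rewrite upd_mk // ?(mkE x) // ?(mkE y).
Qed.

Lemma bits_mk L l M : all (fun v => v < 2 ^ L) l -> bits L M -> bits L (mk l M).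
Proof.
move=> hl hM j; rewrite /mk; case: ifP => // _.
case: (ltnP j (size l)) => h; first by apply: (allP hl); apply: mem_nth.
by rewrite nth_default // expn_gt0.
Qed.

(** No block of the program exceeds 64 instructions. [L] is required at entry only and [L'] absorbs
    the growth inside; the exit state being known exactly, the next block can start from [L]
    again. *)
Lemma triple_mk L L' b l l' M :
    (forall q, q <= 64 -> 2 ^ q * L <= L') -> 5 <= L ->
    all (fun v => v < 2 ^ L) l -> bits L M ->
    all straight b -> all local b -> size b <= 64 ->
    foldl (lexec M) l b = l' ->
  triple L' (blk b) (mk l M) 64 (mk l' M).
Proof.
move=> hB hL hl hM hs hloc hsz <-; rewrite -foldl_exec1_mk //.
apply: (triple_leq hsz); apply: (triple_blk hs hL _ (hB _ hsz)).
exact: bits_mk.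
Qed.

(* The loop states: 12-15 are scratch registers, reset to 0 after each block so *)
(* that the states are known exactly; 16-18 hold the constants 0, 1, 2.        *)
Definition st E n m d X Y num rc ri rj G S : seq nat :=
  [:: E; n; m; d; X; Y; num; rc; ri; rj; G; S; 0; 0; 0; 0; 0; 1; 2].

Lemma all_st L E n m d X Y num rc ri rj G S :
    5 <= L -> all (fun v => v < 2 ^ L) [:: E; n; m; d; X; Y; num; rc; ri; rj; G; S] ->
  all (fun v => v < 2 ^ L) (st E n m d X Y num rc ri rj G S).
Proof.
move=> hL; have h j : j <= 20 -> j < 2 ^ L.
  by move=> hj; apply: (@leq_trans (2 ^ 5)); rewrite ?leq_exp2l //;
    apply: leq_ltn_trans hj _.
rewrite /st /= (h 0 isT) (h 1 isT) (h 2 isT).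
by move=> /and5P[-> -> -> -> /and5P[-> -> -> -> /and5P[-> -> -> -> _]]].
Qed.

Definition pow2 : code := loop 7 (blk [:: IAdd 10 10 10; ISub 7 7 17]).

Lemma triple_pow2 L L' M E n m d X Y num N :
    (forall q, q <= 64 -> 2 ^ q * L <= L') -> 5 <= L -> bits L M -> N < L ->
    all (fun v => v < 2 ^ L) [:: E; n; m; d; X; Y; num] ->
  triple L' pow2 (mk (st E n m d X Y num N 0 0 1 0) M) (N * 66 + 1)
    (mk (st E n m d X Y num 0 0 0 (2 ^ N) 0) M).
Proof.
move=> hB hL hM hN hb.
have hLL : L <= L' by have := hB 0 isT; rewrite mul1n.
have hx i : i < L -> i < 2 ^ L by move=> h; apply: ltn_trans h (ltn_expl L _).
pose F i := mk (st E n m d X Y num i 0 0 (2 ^ (N - i)) 0) M.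
have := @triple_loop L' 7 (blk [:: IAdd 10 10 10; ISub 7 7 17]) F N 64.
rewrite /F subnn subn0; apply => //; first by lia.
- move=> i hi; apply: leq_trans (_ : 2 ^ L <= _); last by rewrite leq_exp2l.
  by apply: hx; lia.
move=> i hi; apply: (triple_mk hB) => //.
- apply: all_st => //.
  move: hb => /= /and5P[-> -> -> -> /and4P[-> -> -> _]].
  rewrite expn_gt0 /= hx /= ?ltn_exp2l //; lia.
rewrite /st; cbv beta iota delta [foldl lexec set_nth nth].
rewrite subn1 /= addnn -mul2n -expnS.
by rewrite -subSn.
Qed.

(** The membership bits of W act as row 0 of a table whose other rows are the voters, with columns
    counted from 1. Registers 0 to 3 hold the length, n, m and k, whence the offset 3. The address
    is selected without branching. *)
Definition ld row r : seq instr :=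
  [:: IMul 12 row 2; IAdd 12 12 r; IConst 13 3; IAdd 12 12 13; IConst 13 19;
      ISub 13 13 12; ISub 14 17 13; IMul 12 12 14; ISub 14 17 14; IMul 13 13 1;
      ISub 13 0 13; IMul 13 13 14; IAdd 12 12 13; ILoad 12 12].

(* Where the input register j lies: the inputs of index j < 19 are moved to    *)
(* E - (19 - j) n to free registers, the others stay; the truncated            *)
(* subtractions 1 - x are the test x = 0.                                      *)
Definition adr E n j :=
  j * (1 - (19 - j)) + (E - (19 - j) * n) * (1 - (1 - (19 - j))).

Definition mem_spec E n m (M : nat -> nat) (a : nat -> nat -> nat) :=
  forall row r, row <= n -> 0 < r <= m ->
    19 <= adr E n (row * m + r + 3) /\ M (adr E n (row * m + r + 3)) = a row r.

Lemma mk_adr E n m M a l row r :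
  mem_spec E n m M a -> row <= n -> 0 < r <= m ->
  mk l M (adr E n (row * m + r + 3)) = a row r.
Proof. by move=> H h1 h2; have [h <-] := H _ _ h1 h2; rewrite /mk ltnNge h. Qed.

Definition inner : seq instr :=
  ld 16 9 ++ [:: IAdd 15 12 16] ++ ld 8 9 ++
  [:: IMul 12 12 15; IAdd 11 11 12; ISub 9 9 17; IConst 12 0; IConst 13 0;
      IConst 14 0; IConst 15 0].

Lemma exec_inner E n m M a d X Y num rc ri rj G S :
    mem_spec E n m M a -> ri <= n -> rj < m ->
  foldl (lexec M) (st E n m d X Y num rc ri rj.+1 G S) inner =
  st E n m d X Y num rc ri rj G (S + a ri rj.+1 * a 0 rj.+1).
Proof.
move=> H hri hrj; rewrite /st /inner /ld.
cbv beta iota delta [foldl lexec set_nth nth cat].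
rewrite -!/(adr _ _ _) !(mk_adr _ H) //.
by rewrite addn0 subn1.
Qed.

(** * The program *)

(** The machine has division but no remainder; [cand_post] computes it this way. *)
Lemma subn_divM x y : x - x %/ y * y = x %% y.
Proof. by rewrite {1}(divn_eq x y) addKn. Qed.

(* Twice the probability that voter i, unless represented by W, approves c.   *)
Definition weight (a : nat -> nat -> nat) m i c :=
  a i c * (1 - \sum_(0 <= j < m) a i j.+1 * a 0 j.+1).

(** On the table of an instance this is [2 ^ n] times the probability generating function, at X, of
    the number of unrepresented voters approving c. *)
Definition genfun a n m X c :=
  \prod_(0 <= i < n) (weight a m i.+1 c * X + (2 - weight a m i.+1 c)).

Definition ngood a n m X Y c := genfun a n m X c %% Y %% (X - 1).

Lemma prod_ngood_leq a n m Y i X : 1 < X ->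
  \prod_(i <= c < m) ngood a n m X Y c.+1 <= X ^ m.
Proof.
move=> hX; apply: (@leq_trans (\prod_(i <= c < m) X)).
  apply: leq_prod => c _; apply: ltnW; apply: (@leq_trans (X - 1).+1); last by lia.
  by rewrite ltnS ltnW // ltn_mod; lia.
rewrite prod_nat_const_nat leq_pexp2l ?leq_subr //; lia.
Qed.

Definition voter_post : seq instr :=
  ISub 11 17 11 :: ld 8 7 ++
  [:: IMul 12 12 11; ISub 13 18 12; IMul 12 12 4; IAdd 12 12 13; IMul 10 10 12;
      ISub 8 8 17; IConst 11 0; IConst 12 0; IConst 13 0; IConst 14 0].

Definition cand_post : seq instr :=
  [:: IDiv 12 10 5; IMul 12 12 5; ISub 10 10 12; ISub 13 4 17; IDiv 12 10 13;
      IMul 12 12 13; ISub 10 10 12; IMul 6 6 10; ISub 7 7 17; IConst 10 0;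
      IConst 12 0; IConst 13 0].

Definition voter_body : code :=
  cseq (blk [:: IAdd 9 2 16]) (cseq (loop 9 (blk inner)) (blk voter_post)).

Definition cand_body : code :=
  cseq (blk [:: IConst 10 1; IAdd 8 1 16])
    (cseq (loop 8 voter_body) (blk cand_post)).

(** * Correctness and cost of the nested loops *)

Section Loops.

Variables (L L' E n m d X Y : nat) (M : nat -> nat) (a : nat -> nat -> nat).
Hypothesis hB : forall q, q <= 64 -> 2 ^ q * L <= L'.
Hypothesis hL : 5 <= L.
Hypothesis hM : bits L M.
Hypothesis hspec : mem_spec E n m M a.
Hypothesis hconst : all (fun v => v < 2 ^ L) [:: E; n; m; d; X; Y].
Hypothesis a_le2 : forall i c, i <= n -> 0 < c <= m -> a i c <= 2.
Hypothesis a0_le1 : forall c, 0 < c <= m -> a 0 c <= 1.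
Hypothesis hm : 2 * m < 2 ^ L.
Hypothesis hX : 2 <= X.
Hypothesis hG : (2 * X) ^ n < 2 ^ L.
Hypothesis hnum : X ^ m < 2 ^ L.

Local Notation S_ num rc ri rj G S := (mk (st E n m d X Y num rc ri rj G S) M).

Lemma L_leq : L <= L'.
Proof. by have := hB (isT : 0 <= 64); rewrite mul1n. Qed.

Lemma lt_pow_L' v w : v <= w -> w < 2 ^ L -> v < 2 ^ L'.
Proof.
move=> h1 h2; apply: leq_ltn_trans h1 (leq_trans h2 _).
by rewrite leq_exp2l // L_leq.
Qed.

Lemma n_lt : n < 2 ^ L. Proof. by case/and5P: hconst => _ ->. Qed.
Lemma m_lt : m < 2 ^ L. Proof. by case/and5P: hconst. Qed.

Lemma all_state num rc ri rj G S :
    all (fun v => v < 2 ^ L) [:: num; rc; ri; rj; G; S] ->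
  all (fun v => v < 2 ^ L) (st E n m d X Y num rc ri rj G S).
Proof.
move=> h; apply: all_st => //.
by rewrite -[_ :: _]/([:: E; n; m; d; X; Y] ++ [:: num; rc; ri; rj; G; S]) all_cat hconst.
Qed.

Lemma triple_inner num rc ri G :
    num < 2 ^ L -> rc <= m -> ri <= n -> G < 2 ^ L ->
  triple L' (loop 9 (blk inner)) (S_ num rc ri m G 0) (m * 66 + 1)
    (S_ num rc ri 0 G (\sum_(0 <= j < m) a ri j.+1 * a 0 j.+1)).
Proof.
move=> hnum' hrc hri hG'; have LL := L_leq.
pose F i := S_ num rc ri i G (\sum_(i <= j < m) a ri j.+1 * a 0 j.+1).
have := @triple_loop L' 9 (blk inner) F m 64.
rewrite /F (big_geq (leqnn m)); apply => //; first by lia.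
  by move=> i hi; apply: lt_pow_L' hi m_lt.
move=> i hi; apply: (triple_mk hB) => //.
  apply: all_state; rewrite /= hnum' hG' (leq_ltn_trans hrc m_lt).
  rewrite (leq_ltn_trans hri n_lt) (leq_ltn_trans hi m_lt) !andbT /=.
  apply: leq_ltn_trans hm; apply: (@leq_trans (\sum_(i.+1 <= j < m) 2)); last first.
    by rewrite sum_nat_const_nat mulnC leq_mul2l leq_subr.
  rewrite big_nat [X in _ <= X]big_nat; apply: leq_sum => j /andP[h1 h2].
  have := a_le2 hri (h2 : 0 < j.+1 <= m); have := a0_le1 (h2 : 0 < j.+1 <= m).
  nia.
by rewrite (exec_inner _ _ _ _ _ _ _ hspec) // [in RHS]big_ltn // addnC.
Qed.

Lemma triple_voter_body num rc ri G :
    num < 2 ^ L -> 0 < rc <= m -> ri < n -> G < 2 ^ L ->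
  triple L' voter_body (S_ num rc ri.+1 0 G 0) (m * 66 + 129)
    (S_ num rc ri 0
       (G * (weight a m ri.+1 rc * X + (2 - weight a m ri.+1 rc))) 0).
Proof.
move=> hnum' hrc hri hG'.
have hrc' : rc < 2 ^ L by case/andP: hrc => _ h; apply: leq_ltn_trans h m_lt.
have hri' : ri.+1 < 2 ^ L by apply: leq_ltn_trans n_lt.
have -> : m * 66 + 129 = 64 + ((m * 66 + 1) + 64) by lia.
set T := \sum_(0 <= j < m) a ri.+1 j.+1 * a 0 j.+1.
have hT : T < 2 ^ L.
  apply: leq_ltn_trans hm; apply: (@leq_trans (\sum_(0 <= j < m) 2)); last first.
    by rewrite sum_nat_const_nat mulnC leq_mul2l leq_subr.
  rewrite /T big_nat [X in _ <= X]big_nat; apply: leq_sum => j /andP[h1 h2].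
  have := a_le2 hri (h2 : 0 < j.+1 <= m); have := a0_le1 (h2 : 0 < j.+1 <= m).
  nia.
have h0 : 0 < 2 ^ L by rewrite expn_gt0.
apply: (@triple_cseq _ _ _ _ _ (S_ num rc ri.+1 m G 0)).
  apply: (triple_mk hB) => //.
    by apply: all_state; rewrite /= hnum' hG' hrc' hri' h0.
  by rewrite /st; cbv beta iota delta [foldl lexec set_nth nth]; rewrite addn0.
apply: (@triple_cseq _ _ _ _ _ (S_ num rc ri.+1 0 G T)).
  by apply: triple_inner => //; case/andP: hrc.
apply: (triple_mk hB) => //.
  by apply: all_state; rewrite /= hnum' hG' hrc' hri' h0 hT.
rewrite /st /voter_post /ld.
cbv beta iota delta [foldl lexec set_nth nth cat].
rewrite -!/(adr _ _ _) !(mk_adr _ hspec) //.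
by rewrite subn1.
Qed.

Lemma weight_le2 i c : i <= n -> 0 < c <= m -> weight a m i c <= 2.
Proof. by move=> hi hc; rewrite /weight; have := a_le2 hi hc; nia. Qed.

Lemma genfun_leq i c : 0 < c <= m ->
  \prod_(i <= v < n) (weight a m v.+1 c * X + (2 - weight a m v.+1 c)) <=
  (2 * X) ^ n.
Proof.
move=> hc; apply: (@leq_trans (\prod_(i <= v < n) (2 * X))).
  rewrite big_nat [X in _ <= X]big_nat; apply: leq_prod => v /andP[_ hv].
  by have := weight_le2 hv hc; nia.
rewrite prod_nat_const_nat leq_pexp2l ?leq_subr //; lia.
Qed.

Lemma triple_cand_body num rc :
    num < 2 ^ L -> rc < m ->
  triple L' cand_body (S_ num rc.+1 0 0 0 0) (n * (m * 66 + 131) + 129)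
    (S_ (num * ngood a n m X Y rc.+1) rc 0 0 0 0).
Proof.
move=> hnum' hrc.
have hrc' : rc.+1 < 2 ^ L by apply: leq_ltn_trans hrc m_lt.
have -> : n * (m * 66 + 131) + 129 = 64 + ((n * ((m * 66 + 129) + 2) + 1) + 64) by lia.
have h0 : 0 < 2 ^ L by rewrite expn_gt0.
apply: (@triple_cseq _ _ _ _ _ (S_ num rc.+1 n 0 1 0)).
  apply: (triple_mk hB) => //; first by apply: all_state; rewrite /= hnum' hrc' h0.
  by rewrite /st; cbv beta iota delta [foldl lexec set_nth nth]; rewrite addn0.
have LL := L_leq.
apply: (@triple_cseq _ _ _ _ _ (S_ num rc.+1 0 0 (genfun a n m X rc.+1) 0)).
  pose F i := S_ num rc.+1 i 0
    (\prod_(i <= v < n) (weight a m v.+1 rc.+1 * X + (2 - weight a m v.+1 rc.+1))) 0.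
  have := @triple_loop L' 8 voter_body F n (m * 66 + 129).
  rewrite /F (big_geq (leqnn n)); apply => //; first by lia.
    by move=> i hi; apply: lt_pow_L' hi n_lt.
  move=> i hi; rewrite (big_ltn hi) (mulnC (_ + _)); apply: triple_voter_body => //.
  by apply: leq_ltn_trans hG; apply: genfun_leq.
apply: (triple_mk hB) => //.
  apply: all_state; rewrite /= hnum' hrc' h0 !andbT /=.
  by apply: leq_ltn_trans hG; apply: genfun_leq.
rewrite /st /cand_post; cbv beta iota delta [foldl lexec set_nth nth].
by rewrite !subn_divM (subn1 rc.+1).
Qed.

Lemma triple_cands :
  triple L' (loop 7 cand_body) (S_ 1 m 0 0 0 0)
    (m * (n * (m * 66 + 131) + 131) + 1)
    (S_ (\prod_(0 <= c < m) ngood a n m X Y c.+1) 0 0 0 0 0).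
Proof.
have LL := L_leq.
pose F i := S_ (\prod_(i <= c < m) ngood a n m X Y c.+1) i 0 0 0 0.
have := @triple_loop L' 7 cand_body F m (n * (m * 66 + 131) + 129).
rewrite -addnA /F (big_geq (leqnn m)); apply => //; first by lia.
  by move=> i hi; apply: lt_pow_L' hi m_lt.
move=> i hi; rewrite (big_ltn hi) (mulnC (ngood _ _ _ _ _ _)).
apply: triple_cand_body => //.
exact: leq_ltn_trans (prod_ngood_leq _ _ _ _ _ hX) hnum.
Qed.

End Loops.

(* All low registers hold input, so there is none for a constant 1: the stores *)
(* advance by R 1 instead.                                                     *)
Definition stores s c : seq instr :=
  flatten [seq [:: IStore 0 j; IAdd 0 0 1] | j <- iota s c].

(** The targets start at b, beyond all sources, and are n > 0 apart, so no store hits a register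
    still to be copied or an earlier target. *)
Lemma exec_stores c s b n R :
    R 0 = b -> R 1 = n -> 0 < n -> 0 < s -> 1 < b -> s + c <= b ->
  let R' := foldl exec1 R (stores s c) in
  [/\ R' 0 = b + c * n, forall j, 0 < j < b -> R' j = R j &
      forall i, i < c -> R' (b + i * n) = R (s + i)].
Proof.
elim: c s b R => [|c IH] s b R h0 h1 hn hs hb hsc /=.
  by split => //; rewrite addn0.
rewrite -/(stores s.+1 c); set R1 := upd _ 0 _.
have R1E j : 0 < j -> R1 j = if j == b then R s else R j.
  move=> hj; rewrite /R1 /upd h0.
  by case: (j == 0) (negbTE (lt0n_neq0 hj)) => // _; case: eqP.
have R10 : R1 0 = b + n.
  rewrite /R1 /upd /= !h0 h1; case: eqP => [|_]; first by lia.
  by case: eqP => //; lia.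
have R11 : R1 1 = n by rewrite R1E //; case: eqP => //; lia.
have [hb' hsc'] : 1 < b + n /\ s.+1 + c <= b + n by lia.
have [k0 kj ki] := IH _ _ _ R10 R11 hn (ltn0Sn s) hb' hsc'.
split; first by rewrite k0 mulSn addnA.
- move=> j hj; rewrite kj; last by lia.
  by rewrite R1E; [case: eqP => //; lia | lia].
- case=> [|i] hi.
    rewrite mul0n !addn0 kj; last by lia.
    by rewrite R1E ?eqxx //; lia.
  rewrite mulSn addnA ki // R1E //.
  by rewrite addSnnS; case: eqP => //; lia.
Qed.

(** Quadrupling [R 0], which is at least 5, gives a base past the input and the low registers.
    Register 0 ends as the address E from which [adr] counts back. *)
Definition relocate : seq instr := [:: IAdd 0 0 0; IAdd 0 0 0] ++ stores 3 16.

Lemma exec_relocate (R : nat -> nat) : 5 <= R 0 -> 0 < R 1 ->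
  let R' := foldl exec1 R relocate in
  [/\ R' 0 = 4 * R 0 + 16 * R 1, R' 1 = R 1, R' 2 = R 2 &
   forall j, 3 <= j <= R 0 -> 19 <= adr (R' 0) (R 1) j /\
     R' (adr (R' 0) (R 1) j) = R j].
Proof.
move=> h0 h1; rewrite /relocate foldl_cat.
set R1 := foldl exec1 R _.
have R10 : R1 0 = 4 * R 0 by rewrite /R1 /= /upd /=; lia.
have R1E j : 0 < j -> R1 j = R j by case: j.
have [hb hsc] : 1 < 4 * R 0 /\ 3 + 16 <= 4 * R 0 by lia.
have := exec_stores R10 (R1E 1 isT) h1 (isT : 0 < 3) hb hsc.
move: (foldl exec1 R1 _) => R' [k0 kj ki].
split; rewrite ?k0 //; first by rewrite kj ?R1E //; lia.
  by rewrite kj ?R1E //; lia.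
move=> j hj; rewrite /adr; case: (leqP 19 j) => hj'.
  have -> : 19 - j = 0 by lia.
  by rewrite /= muln1 muln0 addn0 kj ?R1E //; lia.
have [e1 e2] : 1 - (19 - j) = 0 /\ 1 - (1 - (19 - j)) = 1 by lia.
rewrite e2 e1 muln0 add0n muln1.
have -> : 4 * R 0 + 16 * R 1 - (19 - j) * R 1 = 4 * R 0 + (j - 3) * R 1 by nia.
split; first by nia.
by rewrite ki; [rewrite subnKC ?R1E //; lia | lia].
Qed.

Definition setup : seq instr :=
  [:: IConst 12 16; IMul 12 12 1; ISub 12 0 12; ILoad 3 12; IConst 4 0;
      IConst 5 0; IConst 8 0; IConst 9 0; IConst 10 1; IConst 11 0; IConst 13 0;
      IConst 14 0; IConst 15 0; IConst 16 0; IConst 17 1; IConst 18 2;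
      IAdd 12 1 3; ISub 12 12 17; IDiv 6 12 3; IAdd 7 1 17; IConst 12 0].

(** Register 16 being 0, [IAdd d a 16] copies a to d. The three powers are the digit base, the
    cutoff and the common denominator. *)
Definition program : code :=
  cseq (blk relocate) (
  cseq (blk setup) (
  cseq pow2 (
  cseq (blk [:: IAdd 4 10 16; IAdd 7 1 17; IMul 7 7 6; IConst 10 1]) (
  cseq pow2 (
  cseq (blk [:: IAdd 5 10 16; IMul 7 1 2; IConst 10 1]) (
  cseq pow2 (
  cseq (blk [:: IAdd 3 10 16; IAdd 7 2 16; IConst 6 1; IConst 10 0]) (
  cseq (loop 7 cand_body) (
  blk [:: IAdd 0 6 16; IAdd 1 3 16]))))))))).

Lemma mk_id R : mk (mkseq R 19) R = R.
Proof.
apply: functional_extensionality => j; rewrite /mk.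
by case: ifP => // h; rewrite nth_mkseq.
Qed.

Definition threshold n k := (n + k - 1) %/ k.

(** The digits sum to [2 ^ n], so this base avoids carries and, for n > 0, keeps every partial sum
    of digits below [X - 1]. *)
Definition digit_base n := 2 ^ n.+1.
Definition digit_cutoff n k := 2 ^ (n.+1 * threshold n k).

Lemma digit_base_gt1 n : 0 < n -> 1 < digit_base n.
Proof. by move=> hn; rewrite -[1]/(2 ^ 0) ltn_exp2l. Qed.

Lemma threshold_leq n k : 0 < n -> 0 < k -> threshold n k <= n.
Proof. by move=> hn hk; rewrite /threshold -ltnS ltn_divLR //; nia. Qed.

(** [L0] bounds the bits of the input, [L] those between blocks, [L'] those inside. The last
    hypotheses bound exponents: [n.+1 * n.+2] serves the cutoff and [(2 * X) ^ n], and [n.+1 * m]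
    serves numerator and denominator. *)
Lemma triple_program L0 L L' (R : nat -> nat) n m k (a : nat -> nat -> nat) :
    R 1 = n -> R 2 = m -> R 3 = k -> 0 < n -> 0 < m -> 0 < k <= m ->
    3 + m + n * m <= R 0 ->
    (forall row r, row <= n -> 0 < r <= m -> R (row * m + r + 3) = a row r) ->
    (forall i c, i <= n -> 0 < c <= m -> a i c <= 2) ->
    (forall c, 0 < c <= m -> a 0 c <= 1) ->
    5 <= L0 -> bits L0 R -> 2 ^ size relocate * L0 <= L ->
    (forall q, q <= 64 -> 2 ^ q * L <= L') ->
    4 * R 0 + 16 * n < L -> 2 * m < L -> n.+1 * n.+2 < L -> n.+1 * m < L ->
  exists2 R', triple L' program R
    (6 * 64 + (n.+1 * 66 + 1) + (n.+1 * n.+1 * 66 + 1) + (n * m * 66 + 1) +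
      (m * (n * (m * 66 + 131) + 131) + 1)) R' &
    R' 0 = \prod_(0 <= c < m) ngood a n m (digit_base n) (digit_cutoff n k) c.+1 /\
    R' 1 = 2 ^ (n * m).
Proof.
move=> R1 R2 R3 hn hm hk hsz hR a2 a1 hL0 bR hL hB b1 b2 b3 b4.
have s5 : 5 <= R 0 by nia.
have hLL : L <= L' by have := hB 0 isT; rewrite mul1n.
have L5 : 5 <= L by lia.
set E := 4 * R 0 + 16 * n in b1 *.
set T := threshold n k.
have hT : T <= n by apply: threshold_leq => //; case/andP: hk.
have := exec_relocate s5; rewrite R1 R2 => /(_ hn).
have hreloc := triple_blk (isT : all straight relocate) hL0 bR (leq_trans hL hLL).
have hM := bits_leq hL (bits_foldl (isT : all straight relocate) hL0 bR).
move: hreloc hM; set M := foldl exec1 R relocate => hreloc hM [M0 M1 M2 Madr].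
have lt2 x : x < L -> x < 2 ^ L by move=> h; apply: ltn_trans h (ltn_expl L _).
have lt2' x : x < L -> 2 ^ x < 2 ^ L by move=> h; rewrite ltn_exp2l.
have hspec : mem_spec E n m M a.
  move=> row r hrow hr; rewrite -hR // /E -M0; apply: Madr; nia.
have hkM l : mk l M (E - 16 * n) = k.
  have [] := Madr 3; first by lia.
  rewrite R3 M0 -/E.
  have -> : adr E n 3 = E - 16 * n.
    by rewrite /adr (_ : 1 - (19 - 3) = 0) // muln0 add0n muln1.
  by move=> h <-; rewrite /mk ltnNge h.
have [hn' hm' hE'] : [/\ n < 2 ^ L, m < 2 ^ L & E < 2 ^ L] by split; apply: lt2; nia.
have hT' : T < 2 ^ L by apply: leq_ltn_trans hT hn'.
have hk' : k < 2 ^ L by apply: leq_ltn_trans hm'; case/andP: hk.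
have hX' : digit_base n < 2 ^ L by apply: lt2'; nia.
have hY' : digit_cutoff n k < 2 ^ L by apply: lt2'; rewrite -/T; nia.
have hd' : 2 ^ (n * m) < 2 ^ L by apply: lt2'; nia.
have h0 : 0 < 2 ^ L by rewrite expn_gt0.
have h1 : 1 < 2 ^ L by apply: lt2; lia.
set num := \prod_(0 <= c < m) _.
exists (mk (st num (2 ^ (n * m)) m (2 ^ (n * m)) (digit_base n)
  (digit_cutoff n k) num 0 0 0 0 0) M); last by [].
have hsetup : triple L' (blk setup) M 64 (mk (st E n m k 0 0 T n.+1 0 0 1 0) M).
  rewrite -{1}(mk_id M); apply: (triple_mk hB) => //.
    by apply/allP => x /(nthP 0) [j hj <-]; rewrite size_mkseq in hj; rewrite nth_mkseq.
  rewrite /mkseq /= M0 M1 M2 -/E /setup.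
  by cbv beta iota delta [foldl lexec set_nth nth]; rewrite hkM addn1.
have -> : 6 * 64 + (n.+1 * 66 + 1) + (n.+1 * n.+1 * 66 + 1) + (n * m * 66 + 1) +
    (m * (n * (m * 66 + 131) + 131) + 1) =
  64 + (64 + ((n.+1 * 66 + 1) + (64 + ((n.+1 * n.+1 * 66 + 1) + (64 +
    ((n * m * 66 + 1) + (64 + ((m * (n * (m * 66 + 131) + 131) + 1) + 64)))))))).
  by ring.
have hreloc' := triple_leq (isT : size relocate <= 64) hreloc.
apply: (triple_cseq hreloc').
apply: (triple_cseq hsetup).
have hpow2 := triple_pow2 hB L5 hM.
apply: (triple_cseq (hpow2 _ _ _ _ _ _ _ _ _ _)); first by nia.
  by rewrite /= hE' hn' hm' hk' h0 hT'.
rewrite -/(digit_base n).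
apply: (@triple_cseq _ _ _ _ _ (mk (st E n m k (digit_base n) 0 T (n.+1 * T) 0 0 1 0) M)).
  apply: (triple_mk hB) => //.
    by apply: all_st => //; rewrite /= hE' hn' hm' hk' h0 hT' hX'.
  rewrite /st; cbv beta iota delta [foldl lexec set_nth nth].
  by rewrite addn0 addn1.
apply: triple_cseq.
  (* Bounding the threshold by [n.+1] frees the count from k. *)
  apply: (triple_leq _ (hpow2 _ _ _ _ _ _ _ _ _ _)).
  - by rewrite leq_add2r leq_mul2r leq_mul2l; lia.
  - by nia.
  - by rewrite /= hE' hn' hm' hk' h0 hT' hX'.
rewrite -/(digit_cutoff n k).
apply: (@triple_cseq _ _ _ _ _
  (mk (st E n m k (digit_base n) (digit_cutoff n k) T (n * m) 0 0 1 0) M)).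
  apply: (triple_mk hB) => //.
    by apply: all_st => //; rewrite /= hE' hn' hm' hk' h0 hT' hX' hY'.
  rewrite /st; cbv beta iota delta [foldl lexec set_nth nth].
  by rewrite addn0.
apply: (triple_cseq (hpow2 _ _ _ _ _ _ _ _ _ _)); first by nia.
  by rewrite /= hE' hn' hm' hk' hT' hX' hY'.
apply: (@triple_cseq _ _ _ _ _
  (mk (st E n m (2 ^ (n * m)) (digit_base n) (digit_cutoff n k) 1 m 0 0 0 0) M)).
  apply: (triple_mk hB) => //.
    by apply: all_st => //; rewrite /= hE' hn' hm' hk' h0 hT' hX' hY' hd'.
  rewrite /st; cbv beta iota delta [foldl lexec set_nth nth].
  by rewrite !addn0.
have hnum : digit_base n ^ m < 2 ^ L by rewrite -expnM; apply: lt2'.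
apply: (triple_cseq (triple_cands hB L5 hM hspec _ a2 a1 (lt2 _ b2) _ _ hnum)).
- by rewrite /= hE' hn' hm' hd' hX' hY'.
- exact: digit_base_gt1.
- by rewrite /digit_base -expnS -expnM; apply: lt2'; nia.
rewrite -/num; apply: (triple_mk hB) => //.
  apply: all_st => //; rewrite /= hE' hn' hm' hd' hX' hY' h0 !andbT /=.
  exact: leq_ltn_trans (prod_ngood_leq _ _ _ _ _ (digit_base_gt1 hn)) hnum.
rewrite /st; cbv beta iota delta [foldl lexec set_nth nth].
by rewrite !addn0.
Qed.

(** * The probability *)

Lemma ltn_threshold s n k : 0 < k -> (s < threshold n k) = (s * k < n).
Proof. by move=> hk; rewrite /threshold leq_divRL // mulSn; apply/idP/idP; lia. Qed.

(** In the expanded product a set B contributes its weight times [X ^ #|B|], and all weights sum to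
    [2 ^ n < X]. So the sets smaller than T make up the residue modulo [X ^ T]; as X is 1 modulo
    [X - 1], the second residue adds their weights. *)
Lemma modn_genfun n (e : 'I_n -> nat) T (X := 2 ^ n.+1) :
    0 < n -> 0 < T -> (forall i, e i <= 2) ->
  \prod_i (e i * X + (2 - e i)) %% X ^ T %% (X - 1) =
  \sum_(B : {set 'I_n} | #|B| < T) \prod_i (if i \in B then e i else 2 - e i).
Proof.
move=> hn hT he; pose w (B : {set 'I_n}) := \prod_i (if i \in B then e i else 2 - e i).
have hX : 0 < X by rewrite expn_gt0.
have hXT j : 0 < X ^ j by rewrite expn_gt0 hX.
have hX2 : X = 2 ^ n + 2 ^ n by rewrite /X expnS mul2n addnn.
have h2n : 1 < 2 ^ n by rewrite -[1]/(2 ^ 0) ltn_exp2l.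
have sw : \sum_B w B = 2 ^ n.
  transitivity (\prod_i (e i + (2 - e i))); first by rewrite bigA_distr.
  rewrite (eq_bigr (fun=> 2)) => [|i _]; last by rewrite subnKC.
  by rewrite prod_nat_const card_ord.
have hw (P : pred {set 'I_n}) : \sum_(B | P B) w B <= 2 ^ n.
  by rewrite -sw [in leqRHS](bigID P) leq_addr.
have -> : \prod_i (e i * X + (2 - e i)) = \sum_B w B * X ^ #|B|.
  rewrite bigA_distr; apply: eq_bigr => B _.
  rewrite -prod_nat_const [X in _ = _ * X]big_mkcond -big_split /=.
  by apply: eq_bigr => i _; case: ifP; rewrite ?muln1.
rewrite (bigID (fun B : {set 'I_n} => #|B| < T)) /=.
set low := \sum_(B : {set 'I_n} | #|B| < T) w B * X ^ #|B|.
have [h ->] : exists h, \sum_(B : {set 'I_n} | ~~ (#|B| < T)) w B * X ^ #|B| = h * X ^ T.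
  exists (\sum_(B : {set 'I_n} | ~~ (#|B| < T)) w B * X ^ (#|B| - T)).
  rewrite big_distrl /=; apply: eq_bigr => B; rewrite -leqNgt => hB.
  by rewrite -mulnA -expnD subnK.
have low_lt : low < X ^ T.
  apply: (@leq_ltn_trans (\sum_(B : {set 'I_n} | #|B| < T) w B * X ^ T.-1)).
    apply: leq_sum => B hB; rewrite leq_mul2l leq_pexp2l ?orbT //; lia.
  rewrite -big_distrl /=; apply: (@leq_ltn_trans (2 ^ n * X ^ T.-1)).
    by rewrite leq_mul2r hw orbT.
  by rewrite -[in ltnRHS](prednK hT) expnS ltn_mul2r hXT; lia.
rewrite addnC modnMDl (modn_small low_lt).
have [h' ->] : exists h', low = h' * (X - 1) + \sum_(B : {set 'I_n} | #|B| < T) w B.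
  exists (\sum_(B : {set 'I_n} | #|B| < T) w B * \sum_(i < #|B|) X ^ i).
  rewrite big_distrl -big_split /=; apply: eq_bigr => B _; rewrite /=.
  have := predn_exp X #|B|.
  rewrite -subn1 -[X.-1]subn1 -mulnA [X in _ = _ * X + _]mulnC => <-.
  by rewrite -{3}[w B]muln1 -mulnDr subnK.
by rewrite modnMDl modn_small //; apply: leq_ltn_trans (hw _) _; lia.
Qed.

Local Open Scope ring_scope.

(** The generating polynomial factors over the voters, so that [marginal] can compare factor by
    factor. *)
Lemma sum_coef_genfun n (R : comNzRingType) (q : 'I_n -> R) (d : 'I_n -> nat) T :
  \sum_(B : {set 'I_n} | (\sum_(i in B) d i < T)%N)
     \prod_i (if i \in B then q i else 1 - q i) =
  \sum_(t < T) (\prod_i ((q i)%:P * 'X^(d i) + (1 - q i)%:P))`_t.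
Proof.
rewrite bigA_distr; under [RHS]eq_bigr do rewrite coef_sum.
rewrite exchange_big big_mkcond /=; apply: eq_bigr => B _.
have -> : \prod_i (if i \in B then (q i)%:P * 'X^(d i) else (1 - q i)%:P) =
    (\prod_i (if i \in B then q i else 1 - q i))%:P * 'X^(\sum_(i in B) d i).
  rewrite expr_sum rmorph_prod [X in _ * X]big_mkcond -big_split /=.
  by apply: eq_bigr => i _; case: ifP; rewrite ?mulr1.
under [RHS]eq_bigr do rewrite coefCM coefXn.
rewrite -mulr_sumr; set s := (\sum_(i in B) d i)%N.
case: ltnP => hs; last first.
  rewrite [X in _ * X]big1 ?mulr0 // => t _.
  by rewrite ltn_eqF // (leq_trans (ltn_ord t)).
rewrite (bigD1 (Ordinal hs)) //= eqxx [X in _ + X]big1 ?addr0 ?mulr1 // => t ht.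
by rewrite -[s]/(val (Ordinal hs)) val_eqE (negbTE ht).
Qed.

(** A voter outside U never counts, so its factor is [q i + (1 - q i) = 1], which is also its factor
    once its probability is set to 0. *)
Lemma marginal n (R : comNzRingType) (q : 'I_n -> R) (U : {set 'I_n}) T
    (q' := fun i => if i \in U then q i else 0) :
  \sum_(B : {set 'I_n} | (#|B :&: U| < T)%N) \prod_i (if i \in B then q i else 1 - q i) =
  \sum_(B : {set 'I_n} | (#|B| < T)%N) \prod_i (if i \in B then q' i else 1 - q' i).
Proof.
have h1 (B : {set 'I_n}) : #|B :&: U| = (\sum_(i in B) (i \in U))%N.
  rewrite -sum1_card big_mkcond [RHS]big_mkcond; apply: eq_bigr => i _.
  by rewrite inE; do 2!case: (i \in _).
have h2 (B : {set 'I_n}) : #|B| = (\sum_(i in B) 1)%N by rewrite sum1_card.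
under eq_bigl do rewrite h1; under [RHS]eq_bigl do rewrite h2.
rewrite !sum_coef_genfun; apply: eq_bigr => t _.
congr (nth _ (polyseq _) _); apply: eq_bigr => i _.
rewrite /q'; case: (i \in U) => //.
by rewrite expr0 mulr1 -polyCD addrC subrK polyC0 mul0r add0r subr0.
Qed.

(** A violating group for c lies within the set of unrepresented voters approving c, which therefore
    decides. *)
Lemma is_JRE n m k (A : {ffun 'I_n -> {set 'I_m}}) (W : {set 'I_m}) : (0 < k)%N ->
  is_JR k A W =
  [forall c, #|[set i | c \in A i] :&: [set i | A i :&: W == set0]| * k < n]%N.
Proof.
move=> hk.
have hc (V : {set 'I_n}) : (n%:R / k%:R <= (#|V|%:R : rat)) = (n <= #|V| * k)%N.
  by rewrite ler_pdivrMr ?ltr0n // -natrM ler_nat.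
apply/idP/idP.
  move=> /forallP h; apply/forallP => c; rewrite ltnNge; apply/negP => hn.
  have := h ([set i | c \in A i] :&: [set i | A i :&: W == set0]).
  rewrite hc hn /=; apply/negP; rewrite negb_imply; apply/andP; split.
    by apply/existsP; exists c; apply/forallP => i; rewrite !inE; apply/implyP => /andP[].
  rewrite negb_exists; apply/forallP => i; rewrite !inE.
  by case: (_ == set0); rewrite ?andbF.
move=> /forallP h; apply/forallP => V; apply/implyP; rewrite hc.
move=> /andP[hV /existsP[c /forallP hcV]].
apply/existsP; have := h c; rewrite ltnNge => /negP hn.
case: (pickP [pred i in V | A i :&: W != set0]) => [i hi|hno]; first by exists i.
case: hn; apply: leq_trans hV _; rewrite leq_mul2r; apply/orP; right.
apply/subset_leq_card/subsetP => i hi; rewrite !inE (implyP (hcV i) hi) /=.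
by have := hno i; rewrite /= hi /= => /negbFE.
Qed.

Lemma prod_if0 m (b : pred 'I_m) (g : 'I_m -> rat) :
  \prod_c (if b c then g c else 0) = if [forall c, b c] then \prod_c g c else 0.
Proof.
case: ifP => [/forallP h|/negbT]; first by apply: eq_bigr => c _; rewrite h.
by rewrite negb_forall => /existsP[c hc]; rewrite (bigD1 c) //= (negbTE hc) mul0r.
Qed.

(** Profiles are read candidate by candidate, as families of approver sets; over these families the
    product of sums expands. *)
Lemma JR_probE n m k (p : 'I_n -> 'I_m -> rat) (W : {set 'I_m})
    (U := [set i | [forall c in W, p i c == 0]]) :
    (0 < k)%N -> (forall i c, c \in W -> p i c \in [:: 0; 1]) ->
  JR_prob k p W =
  \prod_c \sum_(B : {set 'I_n} | (#|B :&: U| * k < n)%N)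
     \prod_i (if i \in B then p i c else 1 - p i c).
Proof.
move=> hk hW; under [RHS]eq_bigr do rewrite big_mkcond.
rewrite bigA_distr_bigA /JR_prob big_mkcond /=.
pose h (f : {ffun 'I_m -> {set 'I_n}}) : {ffun 'I_n -> {set 'I_m}} :=
  [ffun i => [set c | i \in f c]].
rewrite (reindex h) /=; last first.
  exists (fun A : {ffun 'I_n -> {set 'I_m}} => [ffun c => [set i | c \in A i]]) => f _;
    by apply/ffunP => x; apply/setP => y; rewrite !ffunE !inE !ffunE !inE.
apply: eq_bigr => f _; rewrite prod_if0.
have -> : \prod_c \prod_i (if i \in f c then p i c else 1 - p i c) = profile_prob p (h f).
  rewrite exchange_big; apply: eq_bigr => i _; apply: eq_bigr => c _.
  by rewrite ffunE inE.
(* A profile of probability 0 contributes 0 to both sides; any other agrees with p on W, so its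
   unrepresented voters are exactly U. *)
have [->|hp] := eqVneq (profile_prob p (h f)) 0; first by do 2!case: ifP.
rewrite is_JRE //; congr (if _ then _ else _); apply: eq_forallb => c.
have -> : [set i | c \in h f i] = f c by apply/setP => i; rewrite !inE ffunE inE.
congr (#|_ :&: _| * _ < _)%N; apply/setP => i; rewrite !inE.
have hf c' : c' \in W -> (c' \in h f i) = (p i c' != 0).
  move=> hc'; move: hp; rewrite /profile_prob (bigD1 i) //= (bigD1 c') //=.
  have := hW i c' hc'; rewrite !inE => /orP[]/eqP ->; case: (c' \in h f i) => //.
  - by rewrite !mul0r eqxx.
  - by rewrite subrr !mul0r eqxx.
apply/eqP/forallP => [h0 c'|h0].
  apply/implyP => hc'; apply/negPn; rewrite -hf //; apply/negP => hc2.
  by have := in_set0 c'; rewrite -h0 inE hc2 hc'.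
apply/setP => c'; rewrite !inE; apply/negP => /andP[hc1 hc2].
by move: hc1; rewrite hf // (implyP (h0 c') hc2).
Qed.

(** * From the encoded input to the probability *)

Lemma nth_allpairs (S T U : Type) (x0 : S) (y0 : T) (z0 : U) (f : S -> T -> U) s t i j :
  (i < size s)%N -> (j < size t)%N ->
  nth z0 [seq f x y | x <- s, y <- t] (i * size t + j) = f (nth x0 s i) (nth y0 t j).
Proof.
elim: s i => [|x s IH] [|i] //= hi hj; rewrite nth_cat size_map.
  by rewrite mul0n add0n hj (nth_map y0).
by rewrite mulSn -addnA ltnNge leq_addr addKn; apply: IH.
Qed.

Section Encoding.

Variables (n m k : nat) (p : 'I_n -> 'I_m -> rat) (W : {set 'I_m}).

Let R := regs (init (encode k p W)).

Lemma size_encode : size (encode k p W) = (3 + m + n * m)%N.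
Proof. by rewrite /= size_cat size_map size_allpairs !size_enum_ord !addSn. Qed.

Lemma reg_member (c : 'I_m) : R (0 * m + c.+1 + 3) = (c \in W) :> nat.
Proof.
rewrite /R mul0n add0n addn3 /= nth_cat size_map size_enum_ord ltn_ord.
by rewrite (nth_map c) ?nth_ord_enum // size_enum_ord.
Qed.

Lemma reg_code (i : 'I_n) (c : 'I_m) : R (i.+1 * m + c.+1 + 3) = code_of (p i c).
Proof.
rewrite /R addn3 mulSn -addnA !addnS /= nth_cat size_map size_enum_ord.
rewrite ltnNge leq_addr addKn /=.
have := @nth_allpairs _ _ _ i c 0%N (fun i c => code_of (p i c))
  (enum 'I_n) (enum 'I_m) i c.
by rewrite !size_enum_ord !ltn_ord !nth_ord_enum => -> .
Qed.

Lemma code_of_leq2 (q : rat) : (code_of q <= 2)%N.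
Proof. by rewrite /code_of; do ?case: ifP. Qed.

Definition table row r := R (row * m + r + 3).

Lemma table_leq2 i c : (i <= n)%N -> (0 < c <= m)%N -> (table i c <= 2)%N.
Proof.
case: i c => [|i] [|c] //= hi hc; rewrite /table.
  by rewrite (reg_member (Ordinal hc)); case: (_ \in _).
by rewrite (reg_code (Ordinal hi) (Ordinal hc)) code_of_leq2.
Qed.

Lemma table0_leq1 c : (0 < c <= m)%N -> (table 0 c <= 1)%N.
Proof.
by case: c => [|c] //= hc; rewrite /table (reg_member (Ordinal hc)); case: (_ \in _).
Qed.

(** The sum in [weight] vanishes exactly when all codes of voter i on W are 0; otherwise it is at
    least 1 and the truncated subtraction gives 0. *)
Lemma weight_table (i : 'I_n) (c : 'I_m) :
  weight table m i.+1 c.+1 =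
  if i \in [set i | [forall c in W, p i c == 0]] then code_of (p i c) else 0%N.
Proof.
rewrite /weight {1}/table reg_code inE big_mkord.
have code0 c' : (code_of (p i c') == 0)%N = (p i c' == 0).
  by rewrite /code_of; do ?case: eqP.
case: forallP => [h|h].
  rewrite big1 ?subn0 ?muln1 // => c' _; rewrite /table reg_code reg_member.
  by have := h c'; rewrite -code0; case: (c' \in W) => /=; [move/eqP-> | rewrite muln0].
have /existsP[c' hc'] : [exists c', ~~ ((c' \in W) ==> (p i c' == 0))].
  by rewrite -negb_forall; apply/negP => /forallP.
move: hc'; rewrite negb_imply -code0 => /andP[hW h0].
rewrite (bigD1 c') //= /table reg_code reg_member hW muln1.
by case: (code_of _) h0 => // x _; rewrite addSn subSS sub0n muln0.
Qed.

Hypothesis n_gt0 : (0 < n)%N.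
Hypothesis k_gt0 : (0 < k)%N.
Hypothesis p_3VA : forall i c, p i c \in [:: 0; 2%:R^-1; 1].

Lemma code_ofK i c : (code_of (p i c))%:R / 2%:R = p i c.
Proof. by have := p_3VA i c; rewrite !inE => /or3P[]/eqP ->. Qed.

(** Codes are doubled probabilities: each of the n voters contributes one factor 2 to the
    denominator. *)
Lemma ngood_prob (c : 'I_m) (U := [set i | [forall c in W, p i c == 0]]) :
  \sum_(B : {set 'I_n} | (#|B :&: U| * k < n)%N)
     \prod_i (if i \in B then p i c else 1 - p i c) =
  (ngood table n m (digit_base n) (digit_cutoff n k) c.+1)%:R / 2%:R ^+ n.
Proof.
under eq_bigl do rewrite -ltn_threshold //.
rewrite marginal /ngood /genfun /digit_cutoff expnM -/(digit_base n) big_mkord.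
pose e i := weight table m (i : 'I_n).+1 c.+1.
have he i : (e i <= 2)%N.
  by rewrite /e weight_table; case: ifP => // _; apply: code_of_leq2.
rewrite (@modn_genfun n e _ n_gt0 _ he); last by rewrite ltn_threshold.
rewrite natr_sum mulr_suml; apply: eq_bigr => B _.
rewrite natr_prod -[X in _ ^+ X](card_ord n) -prodr_const -prodf_div.
apply: eq_bigr => i _.
have -> : (if i \in U then p i c else 0) = (e i)%:R / 2%:R.
  by rewrite /e weight_table; case: ifP => _; rewrite ?code_ofK ?mul0r.
case: ifP => // _; rewrite natrB // mulrBl divff //.
Qed.

Lemma JR_prob_ngood : (forall i c, c \in W -> p i c \in [:: 0; 1]) ->
  (\prod_(0 <= c < m) ngood table n m (digit_base n) (digit_cutoff n k) c.+1)%:R /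
    (2 ^ (n * m))%:R = JR_prob k p W.
Proof.
move=> hW; rewrite JR_probE //; under [RHS]eq_bigr do rewrite ngood_prob.
rewrite prodf_div prodr_const card_ord -exprM big_mkord natr_prod.
by rewrite natrX.
Qed.

End Encoding.

(** * The polynomial time bound *)

Lemma bits_init x : bits (insize x).+4.+1 (regs (init x)).
Proof.
have hx j : (nth 0 x j < 2 ^ (insize x).+4.+1)%N.
  case: (ltnP j (size x)) => hj; last by rewrite nth_default // expn_gt0.
  rewrite -blen_leq // /insize (big_nth 0%N) big_mkord (bigD1 (Ordinal hj)) //=; lia.
case=> [|j] /=; last exact: hx.
have : (size x <= insize x)%N.
  by rewrite /insize -sum1_size; apply: leq_sum => v _.
have := ltn_expl (insize x).+4.+1 (isT : (1 < 2)%N); lia.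
Qed.

(** At most [2000 * s.+1 ^ 3] instructions, each of cost quadratic in [s.+1], give the exponent
    5. *)
Lemma program_time n m s (B C : nat) : (0 < n)%N -> (3 + m + n * m <= s)%N ->
  (0 < m)%N ->
  ((6 * 64 + (n.+1 * 66 + 1) + (n.+1 * n.+1 * 66 + 1) + (n * m * 66 + 1) +
      (m * (n * (m * 66 + 131) + 131) + 1)) * (1 + 5 * (B * (C * s.+1 ^ 2))) <=
   2000 * (1 + 5 * (B * C)) * s.+1 ^ 5)%N.
Proof.
move=> hn hs hm; set N := (X in (X * (1 + _) <= _)%N).
have hN : (N <= 2000 * s.+1 ^ 3)%N.
  have h1 : (n.+1 <= s.+1)%N by nia.
  have h2 : (m <= s.+1)%N by nia.
  have h3 : (n * m <= s.+1)%N by nia.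
  have h4 : (n.+1 * n.+1 <= s.+1 * s.+1)%N by apply: leq_mul.
  have h5 : (n * m * m <= s.+1 * s.+1)%N by apply: leq_mul.
  have h6 : (s.+1 * s.+1 <= s.+1 ^ 3)%N by rewrite mulnn leq_pexp2l.
  have h7 : (s.+1 <= s.+1 ^ 3)%N by rewrite -{1}(expn1 s.+1) leq_pexp2l.
  have h8 : (0 < s.+1 ^ 3)%N by rewrite expn_gt0.
  (* The coefficients add up to 914, well below 2000. *)
  have -> : N = (66 * (n * m * m) + 66 * (n.+1 * n.+1) + 66 * n.+1 +
      197 * (n * m) + 131 * m + 388)%N.
    by rewrite /N; ring.
  move: h1 h2 h3 h4 h5 h6 h7 h8; move: (s.+1 ^ 3)%N (s.+1 * s.+1)%N.
  by move: (n * m * m)%N (n.+1 * n.+1)%N (n * m)%N => *; lia.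
rewrite (expnD s.+1 3 2) mulnACA; apply: leq_mul => //.
by rewrite mulnDl mul1n -!mulnA leq_add2r expn_gt0.
Qed.

(* There is a log-cost RAM program P and a polynomial bound a*(size+1)^d  *)
(* such that on every 3VA instance with p_{i,c} in {0,1} for all c in W,  *)
(* P halts within the bound, outputting numerator R[0] and (nonzero)      *)
(* denominator R[1] of the probability that W satisfies JR.               *)
Theorem theorem9 :
  exists (P : seq instr) (a d : nat),
  forall (n m k : nat) (p : 'I_n -> 'I_m -> rat) (W : {set 'I_m}),
    (0 < n)%N -> (0 < k)%N -> #|W| = k ->
    (forall i c, p i c \in [:: 0; 2%:R^-1; 1]) ->
    (forall i c, c \in W -> p i c \in [:: 0; 1]) ->
    exists (t : nat) (s' : state),
      [/\ halts_with P (init (encode k p W)) t s',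
          (t <= a * (insize (encode k p W)).+1 ^ d)%N,
          regs s' 1 != 0%N &
          (regs s' 0)%:R / (regs s' 1)%:R = JR_prob k p W].
Proof.
(* [B] absorbs the growth inside a block and the length of the code, both independent of the
   input. *)
have [B [hB hP]] : exists B, (forall q, q <= 64 -> 2 ^ q <= B)%N /\
    (blen (size (program 0)) <= B)%N.
  exists (2 ^ 64 + blen (size (program 0)))%N; split=> [q hq|]; last exact: leq_addl.
  by apply: leq_trans (leq_addr _ _); rewrite leq_exp2l.
(* The part [5 * B] pays for the input bits after relocation, the part 40 for addresses and
   exponents. *)
pose C := (5 * B + 40)%N.
exists (program 0), (2000 * (1 + 5 * (B * C)))%N, 5%N => n m k p W hn hk cW p3 pW.
set x := encode k p W; set s := insize x.
have hkm : (0 < k <= m)%N by rewrite hk -cW -[m in (_ <= m)%N]card_ord max_card.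
have hm : (0 < m)%N by case/andP: hkm; apply: leq_trans.
have hsz : (3 + m + n * m <= s)%N.
  by rewrite -(size_encode k p W) -sum1_size; apply: leq_sum.
have B1 : (1 <= B)%N := hB 0%N isT.
pose L := (C * s.+1 ^ 2)%N; pose L' := (B * L)%N.
have hnm : (n <= n * m)%N by rewrite leq_pmulr.
have [bn1 bn2 bn3] : [/\ n.+2 <= s, m.+1 <= s & n.+1 * n.+2 <= s.+1 ^ 2]%N.
  split; [by lia | by lia | rewrite -mulnn; apply: leq_mul; lia].
have LE : (L = 5 * B * s.+1 ^ 2 + 40 * s.+1 ^ 2)%N by rewrite /L /C mulnDl.
have ss : (s.+1 <= s.+1 ^ 2)%N by rewrite -{1}(expn1 s.+1) leq_pexp2l.
have sm : (n.+1 * m <= s.+1 ^ 2)%N by rewrite -mulnn; apply: leq_mul; lia.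
have hLr : (2 ^ size relocate * s.+4.+1 <= L)%N.
  apply: (@leq_trans (B * (5 * s.+1 ^ 2))).
    by apply: leq_mul; [exact: hB | lia].
  by rewrite LE mulnA (mulnC B) leq_addr.
have hLq q : (q <= 64)%N -> (2 ^ q * L <= L')%N by move=> hq; rewrite leq_mul2r hB ?orbT.
have L'L : (L <= L')%N by rewrite leq_pmull.
have R0 : regs (init x) 0 = (3 + m + n * m)%N := size_encode k p W.
have [] := @triple_program s.+4.+1 L L' (regs (init x)) n m k (table k p W)
  erefl erefl erefl hn hm hkm _ (fun _ _ _ _ => erefl) (@table_leq2 n m k p W)
  (@table0_leq1 n m k p W) isT (bits_init x) hLr hLq.
- by rewrite R0.
- by rewrite R0 LE; lia.
- by rewrite LE; lia.
- by rewrite LE; lia.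
- by rewrite LE; lia.
move=> R' hR' [hR0 hR1].
have hcode : code_at (program 0) 0 (program 0) by exists [::], [::]; rewrite cats0.
have [|t ht hrun] := hR' (program 0) 0%N _ hcode.
  by apply: leq_trans hP _; rewrite /L' leq_pmulr // LE; lia.
exists t, (State (0 + size (program 0)) R'); split.
(* The machine halts by running off the end of the code, where [step] is [None]. *)
- rewrite -[t]addn0; apply: (hrun 0%N); apply: HDone.
  by rewrite /step leqnn.
- by apply: leq_trans ht _; apply: program_time.
- by rewrite -[regs _]/R' hR1 expn_eq0.
- by rewrite -[regs _]/R' hR0 hR1; apply: JR_prob_ngood.
Qed.
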